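(* Let $\varTheta=\varTheta_A\times\varTheta_\varSigma$ with $\varTheta_A\subseteq\mathbb{R}^{d\times d}$, $\varTheta_\varSigma\subseteq\mathcal{S}^d_{\succ0}$. Assume that the true parameter $(A_\star,\varSigma_\star)$ lies in the interior of $\varTheta$, and that for $(A_1,\varSigma_1),(A_2,\varSigma_2)\in\varTheta$ one has $f_{A_1,\varSigma_1}(x'|x)=f_{A_2,\varSigma_2}(x'|x)$ for all $x,x'\in\mathbb{R}^d$ if and only if $(A_1,\varSigma_1)=(A_2,\varSigma_2)$. Then $(A_\star,\varSigma_\star)$ is the unique minimizer over $\varTheta$ of the expected score-matching loss $$\mathcal{L}_{\mathrm{sme}}(A,\varSigma)=\mathbb{E}_{(x,x')\sim d^{\mathcal{D}}}\Big[\big\|\nabla_{x'}\log f_{A,\varSigma}(x'|x)-\nabla_{x'}\log f_{A_\star,\varSigma_\star}(x'|x)\big\|_2^2\Big].$$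
   Context: $\mathcal{S}^d_{\succ0}$ is the set of symmetric positive definite $d\times d$ real matrices. The system is $x'=A_\star x+\varSigma_\star^{1/2}w$ with noise $w\in\mathbb{R}^d$ (zero mean, identity covariance) having a known base density $\phi$ that is positive, twice continuously differentiable and has a finite first-order moment. The transition density for parameters $(A,\varSigma)$ is $f_{A,\varSigma}(x'|x)=\det(\varSigma)^{-1/2}\phi\big(\varSigma^{-1/2}(x'-Ax)\big)$. $d^{\mathcal{D}}$ denotes the distribution of the transitions $(x,x')$ in the data set $\mathcal{D}$: its current-state marginal has density $d^{\mathcal{D}}(x)$ and, conditionally on $x$, $x'$ has density $f_{A_\star,\varSigma_\star}(\cdot|x)$. *)

(* Defs.v *)
From HB Require Import structures.
From mathcomp Require Import all_boot all_order all_algebra.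
From mathcomp Require Import all_classical all_reals all_analysis.

Set Implicit Arguments.
Unset Strict Implicit.
Unset Printing Implicit Defensive.

Import Order.TTheory GRing.Theory Num.Theory.
Import numFieldNormedType.Exports.

Local Open Scope classical_set_scope.
Local Open Scope ring_scope.

(* Column vectors carry the sigma-algebra generated by the coordinates, as
   [n.-tuple T] does in the library. For T = R it is the Borel sigma-algebra. *)
Section measurable_cV.
Context {d} {T : measurableType d}.
Variable n : nat.

Let coors : 'I_n -> 'cV[T]_n -> T := fun i x => x i ord0.

Let cV_set0 : g_sigma_preimage coors set0.
Proof. exact: sigma_algebra0. Qed.

Let cV_setC A : g_sigma_preimage coors A -> g_sigma_preimage coors (~` A).
Proof. exact: sigma_algebraC. Qed.

Let cV_bigcup (F : _^nat) : (forall i, g_sigma_preimage coors (F i)) ->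
  g_sigma_preimage coors (\bigcup_i (F i)).
Proof. exact: sigma_algebra_bigcup. Qed.

HB.instance Definition _ := @isMeasurable.Build (measure_tuple_display d)
  'cV[T]_n (g_sigma_preimage coors) cV_set0 cV_setC cV_bigcup.

End measurable_cV.

Lemma measurable_cVP d0 (T0 : measurableType d0) d (T : measurableType d)
    (n : nat) (f : T0 -> 'cV[T]_n) :
  (forall i, measurable_fun [set: T0] (fun x => f x i ord0)) ->
  measurable_fun [set: T0] f.
Proof.
move=> mf _ A mA; move: A mA.
have -> : (measurable : set (set 'cV[T]_n)) =
    g_sigma_preimage (fun i (x : 'cV[T]_n) => x i ord0) by [].
have pre : g_sigma_preimage (fun i => (fun x : 'cV[T]_n => x i ord0) \o f)
    `<=` measurable.
  apply: smallest_sub; first exact: sigma_algebra_measurable.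
  case: n => [|n] in f mf *; first by rewrite big_ord0.
  rewrite -bigcup_mkord_ord; apply: bigcup_sub => i _ B [C mC <-].
  exact: mf.
move=> A mA; apply: pre; rewrite g_sigma_preimage_comp.
by exists A.
Qed.

Lemma measurable_cV_coord d (T : measurableType d) (n : nat) (i : 'I_n) :
  measurable_fun [set: 'cV[T]_n] (fun x => x i ord0).
Proof.
move=> _ Y mY; apply: sub_sigma_algebra.
rewrite -bigcup_seq/=; exists i => /=; first by rewrite mem_index_enum.
by exists Y.
Qed.

Definition cV_cons (T : Type) (n : nat) (tx : T * 'cV[T]_n) : 'cV[T]_n.+1 :=
  \col_i (if unlift ord0 i is Some j then tx.2 j ord0 else tx.1).

Definition cV_uncons (T : Type) (n : nat) (x : 'cV[T]_n.+1) : T * 'cV[T]_n :=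
  (x ord0 ord0, \col_i x (lift ord0 i) ord0).

Lemma cV_consK (T : Type) n : cancel (@cV_cons T n) (@cV_uncons T n).
Proof.
move=> [t x]; rewrite /cV_uncons mxE unlift_none /=; congr pair.
by apply/matrixP => i j; rewrite !mxE liftK /= (ord1 j).
Qed.

Lemma cV_unconsK (T : Type) n : cancel (@cV_uncons T n) (@cV_cons T n).
Proof.
move=> x; apply/matrixP => i j; rewrite mxE (ord1 j).
by case: unliftP => [k ->|->] //=; rewrite mxE.
Qed.

(* [lebesgue_measure] lives on [measurableTypeR R], which has the same carrier
   and the same measurable sets as R but another display. *)
Lemma measurable_cV_cons (R : realType) n :
  measurable_fun [set: measurableTypeR R * 'cV[R]_n]
    (@cV_cons R n : measurableTypeR R * 'cV[R]_n -> 'cV[R]_n.+1).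
Proof.
apply: measurable_cVP => i; have [j ->|->] := unliftP ord0 i.
- rewrite (_ : (fun _ => _) = (fun x : 'cV[R]_n => x j ord0) \o snd).
    by apply: measurableT_comp => //; exact: measurable_cV_coord.
  by apply/funext => tx; rewrite mxE liftK.
- rewrite (_ : (fun _ => _) = (fst : measurableTypeR R * 'cV[R]_n -> R)).
    exact: (@measurable_fst _ _ (measurableTypeR R) 'cV[R]_n).
  by apply/funext => tx; rewrite mxE unlift_none.
Qed.

Lemma measurable_cV_uncons (R : realType) n :
  measurable_fun [set: 'cV[R]_n.+1]
    (@cV_uncons R n : 'cV[R]_n.+1 -> measurableTypeR R * 'cV[R]_n).
Proof.
apply/measurable_fun_pairP; split.
  exact: (@measurable_cV_coord _ R n.+1 ord0).
apply: measurable_cVP => i.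
rewrite (_ : (fun _ => _) = (fun x : 'cV[R]_n.+1 => x (lift ord0 i) ord0)).
  exact: measurable_cV_coord.
by apply/funext => x; rewrite /= mxE.
Qed.

Section lebesgue_cons.
Local Open Scope ereal_scope.
Context {R : realType} (n : nat).
Variable m : {sigma_finite_measure set 'cV[R]_n -> \bar R}.

Definition lebesgue_cons : set 'cV[R]_n.+1 -> \bar R :=
  pushforward (@lebesgue_measure R \x m)
    (@cV_cons R n : measurableTypeR R * 'cV[R]_n -> 'cV[R]_n.+1).

Let mcons := @measurable_cV_cons R n.

Let lebesgue_cons0 : lebesgue_cons set0 = 0.
Proof. by rewrite /lebesgue_cons /pushforward preimage_set0 measure0. Qed.

Let lebesgue_cons_ge0 A : 0 <= lebesgue_cons A.
Proof. exact: measure_ge0. Qed.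

Let lebesgue_cons_sigma_additive : semi_sigma_additive lebesgue_cons.
Proof.
move=> F mF tF mUF; rewrite /lebesgue_cons /pushforward preimage_bigcup.
apply: measure_semi_sigma_additive.
- by move=> k; rewrite -[X in measurable X]setTI; exact: mcons.
- apply/trivIsetP => /= i j _ _ ij; rewrite -preimage_setI.
  by move/trivIsetP : tF => /(_ _ _ _ _ ij) ->//; rewrite preimage_set0.
- by rewrite -preimage_bigcup -[X in measurable X]setTI; exact: mcons.
Qed.

HB.instance Definition _ := isMeasure.Build _ _ _ lebesgue_cons
  lebesgue_cons0 lebesgue_cons_ge0 lebesgue_cons_sigma_additive.

Let lebesgue_cons_sigma_finite : sigma_finite setT lebesgue_cons.
Proof.
have [F FT mF] : sigma_finite setT (@lebesgue_measure R \x m).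
  have /sigma_finiteP[F [TF ndF Foo]] := sigma_finiteT (@lebesgue_measure R).
  have /sigma_finiteP[G [TG ndG Goo]] := sigma_finiteT m.
  exists (fun k => F k `*` G k).
    rewrite -setXTT TF TG predeqE => -[x y]; split.
      move=> [/= [i _ Fix] [j _ Gjy]]; exists (maxn i j) => //; split.
      - by move: x Fix; exact/subsetPset/ndF/leq_maxl.
      - by move: y Gjy; exact/subsetPset/ndG/leq_maxr.
    by move=> [k _ []/= ? ?]; split; exists k.
  move=> k; have [? ?] := Foo k; have [? ?] := Goo k.
  split; first exact: measurableX.
  by rewrite product_measure1E// lte_mul_pinfty// ge0_fin_numE.
exists (fun k => @cV_uncons R n @^-1` F k).
  by rewrite -preimage_bigcup -FT preimage_setT.
move=> k; have [mFk Fk] := mF k; split.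
  by rewrite -[X in measurable X]setTI; exact: (@measurable_cV_uncons R n).
rewrite /lebesgue_cons /pushforward -comp_preimage.
by rewrite (_ : _ \o _ = id) //; apply/funext => tx /=; rewrite cV_consK.
Qed.

HB.instance Definition _ := Measure_isSigmaFinite.Build _ _ _ lebesgue_cons
  lebesgue_cons_sigma_finite.

End lebesgue_cons.

(* Lebesgue measure on R^n: the n-fold product of [lebesgue_measure]. *)
Fixpoint lebesgue_cV {R : realType} (n : nat) :
    {sigma_finite_measure set 'cV[R]_n -> \bar R} :=
  if n is k.+1 then lebesgue_cons (lebesgue_cV k)
  else dirac (0 : 'cV[R]_0).

(* The norm [`|x|] that the library puts on matrices is the sup norm. *)
Definition sqnorm2 {R : realType} n (x : 'cV[R]_n) : R :=
  \sum_(i < n) x i ord0 ^+ 2.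

Definition partial {R : realType} n (i : 'I_n) (g : 'cV[R]_n -> R) :
    'cV[R]_n -> R :=
  'D_(delta_mx i ord0) g.

Definition gradient {R : realType} n (g : 'cV[R]_n -> R) (x : 'cV[R]_n) :
    'cV[R]_n :=
  \col_i partial i g x.

Definition twice_continuously_differentiable {R : realType} n
    (g : 'cV[R]_n -> R) : Prop :=
  [/\ continuous g,
      forall i x, derivable g x (delta_mx i ord0),
      forall i, continuous (partial i g),
      forall i j x, derivable (partial i g) x (delta_mx j ord0) &
      forall i j, continuous (partial j (partial i g))].

Definition posdefmx {R : realType} {n : nat} : set 'M[R]_n :=
  [set S | S^T = S /\
    forall x : 'cV[R]_n, x != 0 -> 0 < (x^T *m S *m x) ord0 ord0].

(* The positive definite square root of S; the default 0 is only used when S is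
   not positive definite. *)
Definition sqrtmx {R : realType} n (S : 'M[R]_n) : 'M[R]_n :=
  xget 0 [set Q | posdefmx Q /\ Q *m Q = S].

Section noise.
Local Open Scope ereal_scope.
Context {R : realType} (n : nat).

Record base_density (phi : 'cV[R]_n -> R) : Prop := {
  base_density_gt0 : forall w, (0 < phi w)%R ;
  base_density_C2 : twice_continuously_differentiable phi ;
  base_density_int1 : \int[lebesgue_cV n]_w (phi w)%:E = 1 ;
  base_density_moment1 :
    \int[lebesgue_cV n]_w (Num.sqrt (sqnorm2 w) * phi w)%:E < +oo ;
  base_density_mean : forall i,
    \int[lebesgue_cV n]_w (w i ord0 * phi w)%:E = 0 ;
  base_density_cov : forall i j,
    (lebesgue_cV n).-integrable setT
      (fun w => (w i ord0 * w j ord0 * phi w)%:E) /\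
    \int[lebesgue_cV n]_w (w i ord0 * w j ord0 * phi w)%:E = (i == j)%:R%:E }.

End noise.

(* Parameters are pairs th = (A, S); [transition_density phi th x' x] is
   f_(A, S)(x' | x). *)
Definition transition_density {R : realType} n (phi : 'cV[R]_n -> R)
    (th : 'M[R]_n * 'M[R]_n) (x' x : 'cV[R]_n) : R :=
  (Num.sqrt (\det th.2))^-1 * phi (invmx (sqrtmx th.2) *m (x' - th.1 *m x)).

Definition score {R : realType} n (phi : 'cV[R]_n -> R)
    (th : 'M[R]_n * 'M[R]_n) (x' x : 'cV[R]_n) : 'cV[R]_n :=
  gradient (fun y => ln (transition_density phi th y x)) x'.

Section data.
Local Open Scope ereal_scope.
Context {R : realType} (n : nat).
Implicit Types (phi p : 'cV[R]_n -> R) (th : 'M[R]_n * 'M[R]_n)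
  (dD : probability ('cV[R]_n * 'cV[R]_n)%type R).

(* dD is the law of the pair (x, x'), with p the density of x. *)
Record transition_law phi th dD p : Prop := {
  state_density_measurable : measurable_fun setT p ;
  state_density_ge0 : forall x, (0 <= p x)%R ;
  state_density_law : forall B : set 'cV[R]_n, measurable B ->
    dD (B `*` setT) = \int[lebesgue_cV n]_(x in B) (p x)%:E ;
  next_state_law : forall B : set ('cV[R]_n * 'cV[R]_n), measurable B ->
    dD B = \int[lebesgue_cV n]_x ((p x)%:E *
      \int[lebesgue_cV n]_(x' in xsection B x)
        (transition_density phi th x' x)%:E) }.

Definition sme_loss phi dD (ths th : 'M[R]_n * 'M[R]_n) : \bar R :=
  'E_dD[fun z => sqnorm2 (score phi th z.2 z.1 - score phi ths z.2 z.1)].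

End data.

(* Interior of X for the subspace topology of S, where X is a subset of S. *)
Definition interior_in (T : topologicalType) (S X : set T) : set T :=
  [set x | S x /\ \forall y \near x, S y -> X y].

Definition unique_minimizer (R : realType) (T : Type) (X : set T)
    (L : T -> \bar R) (t : T) : Prop :=
  [/\ X t, forall s, X s -> (L t <= L s)%E &
      forall s, X s -> (forall r, X r -> (L s <= L r)%E) -> s = t].

(* Main.v *)
Require Import Defs.
From mathcomp Require Import all_boot all_order all_algebra.
From mathcomp Require Import complex ring.
From mathcomp Require Import all_classical all_reals all_analysis.
From mathcomp Require Import measurable_realfun.

(* The loss is nonnegative and vanishes at (As, Ss), so any other minimizer
   (A, S) has zero loss, and its score agrees with the true one almost
   everywhere for the law of (x, x'). That law has density p(x) f_*(x' | x),
   with f_* positive and the scores continuous in x'; so for almost every x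
   with p(x) > 0 the two scores agree for all x'. For such an x the
   log-densities differ by a constant in x', which is 0 because both densities
   integrate to 1, and comparing conditional means gives A x = As x. As p need
   not be positive, this only holds on {p > 0}; but that set is not negligible,
   hence is contained in no hyperplane up to a null set, and A = As. Now
   f(x' | x) depends on x' - A x only, so equality of the densities at one x
   gives equality at every x, and identifiability concludes. *)

Set Implicit Arguments.
Unset Strict Implicit.
Unset Printing Implicit Defensive.

Import Order.TTheory GRing.Theory Num.Theory.
Import numFieldNormedType.Exports.

Local Open Scope classical_set_scope.
Local Open Scope ring_scope.

(** * Square roots of positive definite matrices *)

(** Newton interpolation: a new node [a] is handled by adding a multiple of the product of the
    ['X - b] over the earlier nodes, which vanishes at those nodes and not at [a]. *)
Lemma poly_interpolation (F : fieldType) (g : F -> F) (s : seq F) :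
  exists p : {poly F}, forall x, x \in s -> p.[x] = g x.
Proof.
elim: s => [|a s [p pE]]; first by exists 0.
have [ains|anots] := boolP (a \in s).
  by exists p => x; rewrite inE => /orP[/eqP->|]; exact: pE.
pose q := \prod_(b <- s) ('X - b%:P).
have qa : q.[a] != 0 by rewrite -rootE root_prod_XsubC.
exists (p + ((g a - p.[a]) / q.[a])%:P * q) => x.
rewrite inE !hornerE => /orP[/eqP->|xs].
  by rewrite divfK// addrC subrK.
have /rootP -> : root q x by rewrite root_prod_XsubC.
by rewrite mulr0 addr0 pE.
Qed.

Lemma trmx_horner_mx (F : comNzRingType) n (A : 'M[F]_n.+1) (p : {poly F}) :
  (horner_mx A p)^T = horner_mx A^T p.
Proof.
elim/poly_ind: p => [|p c IH]; first by rewrite !rmorph0 trmx0.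
rewrite !rmorphD !rmorphM /= !horner_mx_X !horner_mx_C linearD/= tr_scalar_mx.
rewrite -[(_ * A)]/(_ *m A) trmx_mul IH.
by congr (_ + _); rewrite -[LHS]/(A^T * _); exact: comm_mx_horner.
Qed.

(** The spectral theorem over [R[i]] gives [C = P^-1 D P] with [D] diagonal and real. The list [s]
    holds the diagonal entries, and a polynomial in [C] is computed entrywise on [D]. This allows
    functional calculus on [A] by interpolating on [s]. *)
Lemma symmetric_horner_mx_eq0 (R : rcfType) n (A : 'M[R]_n.+1) :
  A^T = A -> exists s : seq R, (forall a, a \in s -> eigenvalue A a) /\
    forall p : {poly R}, (forall a, a \in s -> p.[a] = 0) -> horner_mx A p = 0.
Proof.
move=> AT; pose f : {rmorphism R -> R[i]} := real_complex R.
pose C := map_mx f A.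
have CH : C \is hermsymmx.
  apply: realsym_hermsym.
    by rewrite qualifE/= /C map_trmx AT expr0 scale1r map_mx_id.
  by apply/mxOverP => i j; rewrite mxE complex_real.
have CE := orthomx_spectralP (hermitian_normalmx CH).
have /mxOverP Dreal := hermitian_spectral_diag_real CH.
set P := spectralmx C in CE; set D := spectral_diag C in CE Dreal.
have Pu : P \in unitmx := spectral_unit C.
have DE j : D 0 j = f (complex.Re (D 0 j)) by rewrite [RHS]RRe_real.
exists [seq complex.Re (D 0 j) | j <- enum 'I_n.+1]; split=> [a|p p0].
  case/mapP => j _ ->; rewrite -(eigenvalue_map f) -DE.
  (* Row [j] of [P] is a left eigenvector, nonzero because [P] is invertible. *)
  apply/eigenvalueP; exists (row j P).
    rewrite -/C CE !mulmxA -row_mul mulmxV// -!row_mul mul1mx.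
    by rewrite row_mul row_diag_mx -scalemxAl -rowE.
  apply/eqP => /(congr1 (mulmx^~ (invmx P))); rewrite -row_mul mulmxV// mul0mx.
  by move=> /matrixP/(_ 0 j)/eqP; rewrite !mxE eqxx oner_eq0.
apply: (map_mx_inj (f := f)); rewrite map_horner_mx -/C CE horner_mx_uconjC//.
rewrite horner_mx_diag (_ : map_mx _ D = 0) ?raddf0 ?mulmx0 ?mul0mx ?map_mx0//.
apply/matrixP => i j; rewrite !mxE ord1 DE horner_map p0 ?rmorph0//.
by apply/mapP; exists j => //; rewrite mem_enum.
Qed.

Lemma sqnormE (R : pzRingType) n (x : 'cV[R]_n) :
  (x^T *m x) 0 0 = \sum_i x i 0 ^+ 2.
Proof. by rewrite mxE; apply: eq_bigr => i _; rewrite mxE expr2. Qed.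

Lemma trmx_mul_self_ge0 (R : realDomainType) n (x : 'cV[R]_n) : 0 <= (x^T *m x) 0 0.
Proof. by rewrite sqnormE sumr_ge0// => i _; exact: sqr_ge0. Qed.

Lemma trmx_mul_self_eq0 (R : realDomainType) n (x : 'cV[R]_n) :
  (x^T *m x) 0 0 = 0 -> x = 0.
Proof.
rewrite sqnormE => /psumr_eq0P x0; apply/colP => i; rewrite mxE.
by apply/eqP; rewrite -sqrf_eq0 x0// => j _; exact: sqr_ge0.
Qed.

(** For a left eigenvector [v], the quadratic form at [v^T] equals [a] times the squared norm of
    [v]. *)
Lemma posdefmx_eigenvalue_gt0 (R : realType) n (S : 'M[R]_n) a :
  posdefmx S -> eigenvalue S a -> 0 < a.
Proof.
move=> [ST Spos] /eigenvalueP[v vS v0].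
have vT0 : v^T != 0 by rewrite -(inj_eq (@trmx_inj _ _ _)) trmxK trmx0.
have := Spos _ vT0; rewrite trmxK vS -scalemxAl mxE.
have := trmx_mul_self_ge0 v^T; rewrite trmxK => v_ge0.
rewrite pmulr_lgt0// lt_neqAle v_ge0 andbT eq_sym.
apply: contra vT0 => /eqP v_eq0.
by apply/eqP/trmx_mul_self_eq0; rewrite trmxK.
Qed.

(* A fourth root T of S is symmetric, so x^T T^2 x = |T x|^2 >= 0. *)
Lemma posdefmx_sqrt (R : realType) n (S : 'M[R]_n) :
  posdefmx S -> exists Q, posdefmx Q /\ Q *m Q = S.
Proof.
case: n S => [|n] S Sp.
  by exists S; split=> //; apply/matrixP => -[].
have [ST Spos] := Sp.
have [s [sS s0]] := symmetric_horner_mx_eq0 ST.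
have [t tE] := poly_interpolation (fun a => Num.sqrt (Num.sqrt a)) s.
pose T := horner_mx S t.
have TT : T^T = T by rewrite trmx_horner_mx ST.
have T4 : T *m T *m (T *m T) = S.
  (* The polynomial [t] interpolates the fourth root on the spectrum, so [t ^ 4 - 'X] vanishes
     there; positive eigenvalues make the roots genuine. *)
  have : horner_mx S (t * t * (t * t) - 'X) = 0.
    apply: s0 => a sa; have a0 := ltW (posdefmx_eigenvalue_gt0 Sp (sS a sa)).
    rewrite hornerD hornerN !hornerM hornerX tE// -!expr2.
    rewrite sqr_sqrtr ?sqrtr_ge0// sqr_sqrtr// subrr//.
  by rewrite rmorphB !rmorphM/= horner_mx_X => /eqP; rewrite subr_eq0 => /eqP.
exists (T *m T); split=> //; split; first by rewrite trmx_mul TT.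
move=> x x0; rewrite mulmxA -{1}TT -trmx_mul -mulmxA.
rewrite lt_neqAle trmx_mul_self_ge0 andbT eq_sym.
apply/negP => /eqP/trmx_mul_self_eq0 Tx0.
have := Spos _ x0; rewrite -T4 -!mulmxA Tx0 !mulmx0 mxE ltxx.
by [].
Qed.

Lemma posdefmx_unit (R : realType) n (S : 'M[R]_n) : posdefmx S -> S \in unitmx.
Proof.
move=> [ST Spos]; rewrite unitmxE unitfE -det_tr; apply/det0P => -[v v0 vS].
have vT0 : v^T != 0 by rewrite -(inj_eq (@trmx_inj _ _ _)) trmxK trmx0.
by have := Spos _ vT0; rewrite trmxK -{1}ST vS mul0mx mxE ltxx.
Qed.

(** Existence of a root excludes the default value of [xget]. *)
Lemma sqrtmxP (R : realType) n (S : 'M[R]_n) : posdefmx S ->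
  posdefmx (sqrtmx S) /\ sqrtmx S *m sqrtmx S = S.
Proof.
move=> /posdefmx_sqrt[Q SQ]; rewrite /sqrtmx.
by case: xgetP => // /(_ Q).
Qed.

(** * Lebesgue measure under affine maps *)

Section lebesgue_affine.
Context {R : realType}.
Local Notation mu := (@lebesgue_measure R).

Lemma measurable_affine m n (M : 'M[R]_(m, n)) (c : 'cV[R]_m) :
  measurable_fun [set: 'cV[R]_n] (fun x => M *m x + c).
Proof.
apply: measurable_cVP => i.
rewrite (_ : (fun _ => _) =
    fun x : 'cV[R]_n => (\sum_j (M i j * x j ord0)) + c i ord0); last first.
  by apply/funext => x; rewrite !mxE.
apply: measurable_funD => //; apply: measurable_sum => j.
by apply: measurable_funM => //; exact: measurable_cV_coord.
Qed.

(** Block form of [cV_cons], so that block matrices act on it by block multiplication. *)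
Lemma cV_consE n (t : R) (x : 'cV[R]_n) : cV_cons (t, x) = col_mx t%:M x :> 'cV_(1 + n).
Proof.
apply/colP => i; rewrite mxE; have [j ->|->] := unliftP ord0 i.
  by rewrite (_ : lift ord0 j = rshift 1 j) ?col_mxEd//; apply/val_inj.
have -> : @ord0 n = lshift n (@ord0 0) by apply/val_inj.
by rewrite col_mxEu mxE.
Qed.

Local Open Scope ereal_scope.

(** By uniqueness of Lebesgue measure: the pushforward under [t -> a t + b], multiplied by [|a|],
    gives half-open intervals their length. *)
Lemma lebesgue_measure_affine (a b : R) (A : set (measurableTypeR R)) :
  a != 0%R -> measurable A ->
  mu [set t : measurableTypeR R | A (a * t + b)%R] = `|a|^-1%:E * mu A.
Proof.
move=> a0 mA.
have a_gt0 : (0 < `|a|)%R by rewrite normr_gt0.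
have mf : measurable_fun [set: measurableTypeR R]
    (fun t : measurableTypeR R => (a * t + b)%R : measurableTypeR R).
  by apply: measurable_funD => //; apply: measurable_funM.
pose f (t : measurableTypeR R) : measurableTypeR R := (a * t + b)%R.
pose m0 := (pushforward mu f : measure (measurableTypeR R) R).
pose m := mscale (NngNum (ltW a_gt0)) (m0 mf).
rewrite [X in _ = _ * X](@lebesgue_measure_unique R m)//; last first.
  move=> _ [[x y] _ <-]/=.
  rewrite /mscale/= /pushforward.
  have [a_pos|a_neg] := ltP 0%R a.
    rewrite (_ : _ @^-1` _ = `]((x - b) / a)%R, ((y - b) / a)%R]%classic); last first.
      apply/seteqP; split => t; rewrite /= !in_itv/= ltr_pdivrMr// ler_pdivlMr//;
        by rewrite ltrBlDr lerBrDr mulrC.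
    rewrite !lebesgue_measure_itv/= !lte_fin ltr_pM2r ?invr_gt0// ltrD2r.
    case: ifP => _; last by rewrite mule0.
    by rewrite gtr0_norm// -EFinB -!EFinD -EFinM; congr EFin; field.
  have {}a_neg : (a < 0)%R by rewrite lt_neqAle a0.
  (* A negative slope swaps the endpoints, so the closed end is now on the left; the length is
     unaffected. *)
  rewrite (_ : _ @^-1` _ = `[((y - b) / a)%R, ((x - b) / a)%R[%classic); last first.
    apply/seteqP; split => t; rewrite /= !in_itv/= ltr_ndivlMr// ler_ndivrMr//;
      by rewrite ltrBlDr lerBrDr mulrC => /andP[-> ->].
  rewrite !lebesgue_measure_itv/= !lte_fin ltr_nM2r ?invr_lt0// ltrD2r.
  case: ifP => _; last by rewrite mule0.
  by rewrite ltr0_norm// -!EFinD -EFinM; congr EFin; field.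
rewrite /m /mscale/= muleA -EFinM mulVf ?mul1e// gt_eqF//.
Qed.

Lemma preimage_cV_cons_measurable n (A : set 'cV[R]_n.+1) : measurable A ->
  measurable ((@cV_cons R n : measurableTypeR R * 'cV[R]_n -> _) @^-1` A).
Proof.
by move=> mA; rewrite -[X in measurable X]setTI; exact: measurable_cV_cons.
Qed.

Lemma lebesgue_cVS n (A : set 'cV[R]_n.+1) : lebesgue_cV n.+1 A =
  (mu \x lebesgue_cV n) ((@cV_cons R n : measurableTypeR R * 'cV[R]_n -> _) @^-1` A).
Proof. by []. Qed.

(** The product measure may be computed in either order; here the slices are lines with a fixed
    tail. *)
Lemma lebesgue_cVS2 n (A : set 'cV[R]_n.+1) : measurable A -> lebesgue_cV n.+1 A =
  (mu \x^ lebesgue_cV n) ((@cV_cons R n : measurableTypeR R * 'cV[R]_n -> _) @^-1` A).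
Proof.
move=> mA; rewrite lebesgue_cVS; apply: product_measure_unique => [B C mB mC|].
  by rewrite /= product_measure2E.
exact: preimage_cV_cons_measurable.
Qed.

(** Cavalieri's principle: [G] preserves the first coordinate and scales the measure of preimages in
    every slice by the same [k], so integrating over the slices gives the same factor. *)
Lemma lebesgue_cV_fiber_tail n (F : R -> 'cV[R]_n -> 'cV[R]_n) (k : R)
    (G : 'cV[R]_n.+1 -> 'cV[R]_n.+1) (A : set 'cV[R]_n.+1) :
  (0 <= k)%R -> measurable A -> 
  (forall t x, G (cV_cons (t, x)) = cV_cons (t, F t x)) ->
  (forall t B, measurable B -> lebesgue_cV n (F t @^-1` B) = k%:E * lebesgue_cV n B) ->
  lebesgue_cV n.+1 (G @^-1` A) = k%:E * lebesgue_cV n.+1 A.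
Proof.
move=> k0 mA GE FE; rewrite !lebesgue_cVS /product_measure1.
rewrite -ge0_integralZl//; last first.
  by apply: measurable_fun_xsection; exact: preimage_cV_cons_measurable.
apply: eq_integral => t _ /=; rewrite -(FE t); last first.
  by apply: measurable_xsection; exact: preimage_cV_cons_measurable.
by congr (lebesgue_cV n _); apply/seteqP; split=> x;
  rewrite /xsection/= !inE/= GE.
Qed.

(** Cavalieri's principle again, with the tail preserved and the one-dimensional slices scaled. *)
Lemma lebesgue_cV_fiber_head n (F : 'cV[R]_n -> R -> R) (k : R)
    (G : 'cV[R]_n.+1 -> 'cV[R]_n.+1) (A : set 'cV[R]_n.+1) :
  (0 <= k)%R -> measurable A -> measurable (G @^-1` A) ->
  (forall t x, G (cV_cons (t, x)) = cV_cons (F x t, x)) ->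
  (forall x (B : set (measurableTypeR R)), measurable B -> mu (F x @^-1` B) = k%:E * mu B) ->
  lebesgue_cV n.+1 (G @^-1` A) = k%:E * lebesgue_cV n.+1 A.
Proof.
move=> k0 mA mGA GE FE; rewrite !lebesgue_cVS2// /product_measure2.
rewrite -ge0_integralZl//; last first.
  by apply: measurable_fun_ysection; exact: preimage_cV_cons_measurable.
apply: eq_integral => x _ /=; rewrite -(FE x); last first.
  by apply: measurable_ysection; exact: preimage_cV_cons_measurable.
by congr (mu _); apply/seteqP; split=> t;
  rewrite /ysection/= !inE/= GE.
Qed.

Lemma measurable_translation_preimage n (c : 'cV[R]_n) (A : set 'cV[R]_n) :
  measurable A -> measurable [set x | A (x + c)%R].
Proof.
move=> mA; have := measurable_affine 1%:M c; under eq_fun do rewrite mul1mx.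
by move=> mf; rewrite -[X in measurable X]setTI; exact: mf.
Qed.

(** Induction on [n]: a translation is a translation of the first coordinate composed with one of
    the tail. In dimension 0 there is a single point. *)
Lemma lebesgue_cV_translation n (c : 'cV[R]_n) (A : set 'cV[R]_n) : measurable A ->
  lebesgue_cV n [set x | A (x + c)%R] = lebesgue_cV n A.
Proof.
elim: n => [|n IH] in c A *.
  move=> _; congr (lebesgue_cV 0 _).
  by apply/seteqP; split=> x; rewrite /= [(_ + _)%R]flatmx0 [x]flatmx0.
move=> mA; set c0 := c ord0 ord0; set c' : 'cV[R]_n := (cV_uncons c).2.
have cE : c = cV_cons (c0, c') by rewrite -[LHS]cV_unconsK.
have consD (t t' : R) (x x' : 'cV[R]_n) :
    (cV_cons (t, x) + cV_cons (t', x') = cV_cons ((t + t')%R, (x + x')%R))%R.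
  by apply/colP => i; rewrite !mxE; case: unliftP => //= j _; rewrite mxE.
pose G1 (x : 'cV[R]_n.+1) := (x + cV_cons (0%R : R, c'))%R.
pose G0 (x : 'cV[R]_n.+1) := (x + cV_cons (c0, 0%R : 'cV[R]_n))%R.
rewrite (_ : [set x | _] = G1 @^-1` (G0 @^-1` A)); last first.
  by apply/seteqP; split => x; rewrite /G1 /G0 /= -addrA consD add0r addr0 -cE.
rewrite (@lebesgue_cV_fiber_tail _ (fun _ x => x + c')%R 1%R)//; last 3 first.
- exact: measurable_translation_preimage.
- by move=> t x; rewrite /G1 consD addr0.
- by move=> t B mB; rewrite mul1e; exact: IH.
rewrite mul1e (@lebesgue_cV_fiber_head _ (fun _ t => t + c0)%R 1%R)// ?mul1e//.
- exact: measurable_translation_preimage.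
- by move=> t x; rewrite /G0 consD addr0.
- move=> x B mB; have := lebesgue_measure_affine c0 (oner_neq0 R) mB.
  rewrite normr1 invr1; under [X in mu X]eq_set do rewrite mul1r.
  exact.
Qed.

(** Linear change of variables, stated as a predicate on [M] so that it can be carried through
    matrix factorizations. *)
Definition lebesgue_det_rule n (M : 'M[R]_n) := forall A, measurable A ->
  lebesgue_cV n [set x | A (M *m x)%R] = (`|\det M|^-1)%R%:E * lebesgue_cV n A.

Lemma measurable_mulmx_preimage n (M : 'M[R]_n) (A : set 'cV[R]_n) : measurable A ->
  measurable [set x | A (M *m x)%R].
Proof.
move=> mA; have := measurable_affine M 0%R.
under eq_fun do rewrite addr0.
by move=> mf; rewrite -[X in measurable X]setTI; exact: mf.
Qed.

Lemma lebesgue_det_ruleM n (M N : 'M[R]_n) :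
  lebesgue_det_rule M -> lebesgue_det_rule N -> lebesgue_det_rule (M *m N)%R.
Proof.
move=> hM hN A mA; have -> : [set x | A (M *m N *m x)%R] =
    [set x | [set y | A (M *m y)%R] (N *m x)%R].
  by apply/seteqP; split=> x /=; rewrite mulmxA.
rewrite hN ?hM//; last exact: measurable_mulmx_preimage.
by rewrite muleA -EFinM det_mulmx normrM invfM mulrC.
Qed.

(** The first coordinate [t] is kept, and the tail undergoes [D] followed by the translation by
    [t c]. *)
Lemma lebesgue_det_rule_lblock n (c : 'cV[R]_n) (D : 'M[R]_n) :
  lebesgue_det_rule D -> lebesgue_det_rule (block_mx 1%:M 0 c D : 'M[R]_(1 + n)).
Proof.
move=> hD A mA; rewrite det_lblock det1 mul1r.
apply: (@lebesgue_cV_fiber_tail _ (fun t x => D *m x + c *m t%:M)%R) => //.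
- move=> t x; rewrite !cV_consE mul_block_col mul1mx mul0mx addr0.
  by rewrite [(c *m _ + _)%R]addrC.
- move=> t B mB; rewrite -(lebesgue_cV_translation (c *m t%:M)%R mB) -hD//.
  exact: measurable_translation_preimage.
Qed.

(** The tail is kept, and the first coordinate undergoes an affine map of slope [a]. *)
Lemma lebesgue_det_rule_ublock n (a : R) (b : 'rV[R]_n) : a != 0%R ->
  lebesgue_det_rule (block_mx a%:M b 0 1%:M : 'M[R]_(1 + n)).
Proof.
move=> a0 A mA; rewrite det_ublock det1 mulr1 det_scalar1.
apply: (@lebesgue_cV_fiber_head _ (fun x t => a * t + (b *m x) 0 0)%R) => //.
- exact: measurable_mulmx_preimage.
- move=> t x; rewrite !cV_consE mul_block_col mul1mx mul0mx add0r.
  by rewrite -scalar_mxM raddfD /= -mx11_scalar.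
- by move=> x B mB; exact: lebesgue_measure_affine.
Qed.

(** Gaussian elimination by induction on the dimension: an invertible matrix is a product of block
    triangular ones, for which Cavalieri's principle applies. *)
Lemma lebesgue_cV_linear n (M : 'M[R]_n) : M \in unitmx -> lebesgue_det_rule M.
Proof.
elim: n => [|n IH] in M *.
  move=> _ A mA; rewrite det_mx00 normr1 invr1 mul1e; congr (lebesgue_cV 0 _).
  by apply/seteqP; split=> x; rewrite /= [(_ *m _)%R]flatmx0 [x]flatmx0.
have corner (a : R) (b : 'rV[R]_n) (c : 'cV[R]_n) (D : 'M[R]_n) : a != 0%R ->
    (block_mx a%:M b c D : 'M[R]_(1 + n)) \in unitmx ->
    lebesgue_det_rule (block_mx a%:M b c D : 'M[R]_(1 + n)).
  (* Block LU factorization; the lower right block of the first factor is the Schur complement of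
     [a], to which the induction hypothesis applies. *)
  move=> a0; have -> : block_mx a%:M b c D =
      (block_mx 1%:M 0 (a^-1 *: c) (D - a^-1 *: (c *m b)) *m block_mx a%:M b 0 1%:M)%R.
    rewrite mulmx_block !mul1mx !mul0mx !mulmx0 !mulmx1 !addr0.
    by rewrite mul_mx_scalar scalerA divff// scale1r -scalemxAl addrC subrK.
  rewrite unitmx_mul => /andP[lu _].
  apply: lebesgue_det_ruleM; last exact: lebesgue_det_rule_ublock.
  apply: lebesgue_det_rule_lblock; apply: IH.
  by move: lu; rewrite !unitmxE det_lblock det1 mul1r.
rewrite -[M](@submxK _ 1 n 1 n) => Mu.
set a := ulsubmx _ in Mu *; set b := ursubmx _ in Mu *.
set c := dlsubmx _ in Mu *; set D := drsubmx _ in Mu *.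
clearbody a b c D; move: Mu; rewrite [a]mx11_scalar.
have [a0|a0] := eqVneq (a ord0 ord0) 0%R; last exact: corner.
(* With a zero corner, [c] cannot vanish as well, since the whole first column would be zero. *)
rewrite a0 => Mu; have [i ci0] : exists i, c i ord0 != 0%R.
  apply/existsP; apply: contraT; rewrite negb_exists => /forallP c0.
  have c_eq0 : c = 0%R.
    by apply/colP => i; rewrite mxE; apply/eqP; rewrite -[_ == _]negbK; exact: c0.
  move: Mu; rewrite c_eq0 unitmxE (@det_ublock _ 1 n) det_scalar1 mul0r unitr0.
  by [].
pose e : 'rV[R]_n := delta_mx ord0 i.
have ec : (e *m c = (c i ord0)%:M)%R.
  by rewrite [LHS]mx11_scalar -rowE mxE.
(* The shear by -e makes the corner coefficient c_i, which is nonzero. *)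
have -> : (block_mx 0%R%:M b c D = block_mx 1%:M (- e) 0 1%:M *m
    block_mx (c i ord0)%:M (b + e *m D) c D)%R.
  rewrite mulmx_block !mul1mx !mul0mx !add0r !mulNmx ec.
  by rewrite subrr addrK raddf0.
apply: lebesgue_det_ruleM.
  exact: (lebesgue_det_rule_ublock (- e) (oner_neq0 R)).
apply: corner => //.
rewrite (_ : block_mx _ _ _ _ = block_mx 1%:M e 0 1%:M *m block_mx 0%R%:M b c D)%R; last first.
  by rewrite mulmx_block !mul1mx !mul0mx !add0r ec raddf0 add0r.
by rewrite unitmx_mul Mu andbT unitmxE (@det_ublock _ 1 n) !det1 mulr1 unitr1.
Qed.

Lemma lebesgue_cV_affine n (M : 'M[R]_n) (c : 'cV[R]_n) (A : set 'cV[R]_n) :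
  M \in unitmx -> measurable A ->
  lebesgue_cV n [set x | A (M *m x + c)%R] = (`|\det M|^-1)%R%:E * lebesgue_cV n A.
Proof.
move=> Mu mA; rewrite -(lebesgue_cV_translation c mA).
exact: (lebesgue_cV_linear Mu (measurable_translation_preimage c mA)).
Qed.

(** As [b] has rank 1, it factors as an invertible scalar, the first coordinate form [pid_mx 1], and
    an invertible matrix. The hyperplane is thus a linear preimage of the set where the first
    coordinate is 0, which is null as the product of a point with the full space. *)
Lemma lebesgue_cV_hyperplane n (b : 'rV[R]_n) : b != 0%R ->
  lebesgue_cV n [set x | (b *m x = 0)%R] = 0.
Proof.
case: n => [|n] in b *; first by rewrite [b]thinmx0 eqxx.
move=> b0; have rb : \rank b = 1%N.
  by apply/eqP; rewrite eqn_leq rank_leq_row lt0n mxrank_eq0.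
have Eu := row_ebase_unit b.
pose H : set 'cV[R]_n.+1 := [set x | x ord0 ord0 = 0%R].
have mH : measurable H.
  rewrite -[X in measurable X]setTI.
  exact: (@measurable_cV_coord _ R n.+1 ord0 measurableT [set 0%R]).
rewrite (_ : [set x | _] = [set x | H (row_ebase b *m x)%R]); last first.
  have bE x : (b *m x =
      col_ebase b *m ((pid_mx 1 : 'M[R]_(1, n.+1)) *m (row_ebase b *m x)))%R.
    by have := mulmx_ebase b; rewrite rb !mulmxA => ->.
  apply/seteqP; split => x; rewrite /H/= bE.
    move=> /(congr1 (mulmx (invmx (col_ebase b)))).
    rewrite mulKmx ?col_ebase_unit// mulmx0 => /matrixP/(_ ord0 ord0).
    rewrite mxE (bigD1 ord0)//= [X in (X * _)%R]mxE/= mul1r big1 => [|i i0].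
      by rewrite addr0 [RHS]mxE.
    by rewrite mxE eq_sym -val_eqE in i0 *; rewrite (negbTE i0) mul0r.
  move=> h.
  have -> : ((pid_mx 1 : 'M[R]_(1, n.+1)) *m (row_ebase b *m x) = 0)%R; last first.
    by rewrite mulmx0.
  apply/matrixP => i j; rewrite !ord1 mxE (bigD1 ord0)//= h mulr0 add0r.
  rewrite big1 ?mxE// => k k0.
  by rewrite mxE eq_sym -val_eqE in k0 *; rewrite (negbTE k0) mul0r.
rewrite lebesgue_cV_linear// (_ : lebesgue_cV n.+1 H = 0) ?mule0//.
rewrite lebesgue_cVS (_ : _ @^-1` _ = [set 0%R : measurableTypeR R] `*` setT).
  by rewrite product_measure1E//= lebesgue_measure_set1 mul0e.
have cons0 t x : @cV_cons R n (t, x) ord0 ord0 = t by rewrite mxE unlift_none.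
by apply/seteqP; split=> -[t x]; rewrite /H/= cons0// => -[].
Qed.

End lebesgue_affine.

(** * Open sets and Lebesgue measure *)

Section open_cV.
Context {R : realType}.

(** The open ball of the sup norm, written by coordinates to display it as a product of
    intervals. *)
Definition cV_box n (x : 'cV[R]_n) (e : R) : set 'cV[R]_n :=
  [set y | forall i, `|x i ord0 - y i ord0| < e].

Lemma nbhs_cV_box n (x : 'cV[R]_n) (U : set 'cV[R]_n) :
  nbhs x U -> exists2 e, 0 < e & cV_box x e `<=` U.
Proof.
move=> /nbhs_ballP[e /= e0 xU]; exists e => // y xy; apply: xU; split=> // i j.
by rewrite ord1; exact: xy.
Qed.

Lemma measurable_cV_box n (x : 'cV[R]_n) e : measurable (cV_box x e).
Proof.
have -> : cV_box x e = \bigcap_(i in [set: 'I_n])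
    ((fun y : 'cV[R]_n => y i ord0) @^-1` ball (x i ord0) e).
  by apply/seteqP; split=> [y xy i _|y xy i]; [exact: xy|exact: (xy i)].
apply: fin_bigcap_measurable => [|i _]; first exact: finite_finset.
rewrite -[X in measurable X]setTI; apply: measurable_cV_coord => //.
exact: measurable_ball.
Qed.

(** An open set is the union of the boxes it contains that have a rational centre and radius
    [1 / (k + 1)]; there are countably many. *)
Lemma open_measurable_cV n (U : set 'cV[R]_n) : open U -> measurable U.
Proof.
move=> oU.
pose B (qk : 'cV[rat]_n * nat) := cV_box (map_mx ratr qk.1 : 'cV[R]_n) qk.2.+1%:R^-1.
have -> : U = \bigcup_qk (if `[< B qk `<=` U >] then B qk else set0).
  apply/seteqP; split=> [x Ux|x [qk _]]; last first.
    by case: ifPn => // /asboolP BU; exact: BU.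
  have [e e0 xU] := nbhs_cV_box (open_nbhs_nbhs (conj oU Ux)).
  (* With a radius below [e / 2] and a centre closer to [x] than this radius, the box contains [x]
     and lies within distance [e] of it. *)
  have [k ke] : exists k, k.+1%:R^-1 < e / 2.
    exists (Num.truncn (e / 2)^-1); rewrite invf_plt ?posrE ?divr_gt0//.
    exact: truncnS_gt.
  have qP i : exists q : rat, `|ratr q - x i ord0| < k.+1%:R^-1.
    have : x i ord0 - k.+1%:R^-1 < x i ord0 + k.+1%:R^-1.
      by rewrite ltrD2l gtrN// invr_gt0.
    by move=> /rat_in_itvoo[q]; rewrite in_itv/= -ltr_distl => ?; exists q.
  pose q : 'cV[rat]_n := \col_i projT1 (cid (qP i)).
  have qE i : `|ratr (q i ord0) - x i ord0| < k.+1%:R^-1 by rewrite mxE; case: cid.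
  exists (q, k) => //; case: ifPn => [_ i|/asboolP]; first by rewrite mxE.
  case=> y qy; apply: xU => i.
  rewrite (splitr e) (le_lt_trans (ler_distD (ratr (q i ord0)) _ _))//.
  rewrite ltrD// (lt_trans _ ke)//; first by rewrite distrC.
  by have := qy i; rewrite mxE.
apply: countable_bigcupT_measurable => [|qk]; first exact: countableP.
by case: ifP => _ //; exact: measurable_cV_box.
Qed.

Lemma continuous_measurable_cV n (f : 'cV[R]_n -> R) :
  continuous f -> measurable_fun setT f.
Proof.
move=> cf; apply: (measurability _ (RGenOInfty.measurableE R)) => //.
move=> _ [_ [a ->] <-]; rewrite setTI; apply: open_measurable_cV.
by move/continuousP : cf; apply; exact: interval_open.
Qed.

Local Open Scope ereal_scope.

Lemma lebesgue_cV_box_gt0 n (x : 'cV[R]_n) e : (0 < e)%R ->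
  0 < lebesgue_cV n (cV_box x e).
Proof.
move=> e0; elim: n => [|n IH] in x *.
  by rewrite /= diracE mem_set ?lte01// => -[].
have -> : lebesgue_cV n.+1 (cV_box x e) =
    (@lebesgue_measure R \x lebesgue_cV n)
      (ball (x ord0 ord0) e `*` cV_box (cV_uncons x).2 e).
  congr ((@lebesgue_measure R \x lebesgue_cV n) _).
  apply/seteqP; split=> -[t y] /=.
    move=> xy; split=> [|i]; first by have := xy ord0; rewrite mxE unlift_none.
    by have := xy (lift ord0 i); rewrite !mxE liftK.
  by move=> [xt xy] i; rewrite mxE; case: unliftP => [j ->|->]//;
    have := xy j; rewrite mxE.
rewrite product_measure1E//; last 2 first.
- exact: measurable_ball.
- exact: measurable_cV_box.
apply: mule_gt0; last exact: IH.
by rewrite [X in _ < X](lebesgue_measure_ball _ (ltW e0)) lte_fin mulrn_wgt0.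
Qed.

Lemma lebesgue_cV_open_gt0 n (U : set 'cV[R]_n) : open U -> U !=set0 ->
  0 < lebesgue_cV n U.
Proof.
move=> oU [x Ux]; have [e e0 xU] := nbhs_cV_box (open_nbhs_nbhs (conj oU Ux)).
apply: (lt_le_trans (lebesgue_cV_box_gt0 x e0)).
by apply: le_measure => //; rewrite inE;
  [exact: measurable_cV_box|exact: open_measurable_cV].
Qed.

End open_cV.

(** * Directional derivatives *)

Section directional_derivatives.
Context {R : realType}.

Lemma is_deriveP (V W : normedModType R) (f : V -> W) x v d :
  is_derive x v f d <->
  (h^-1 *: (f (h *: v + x) - f x)) @[h --> 0^'] --> d.
Proof.
split=> [[df <-]|fd].
  by rewrite /derive; move: df => /cvg_ex[l fl]; rewrite (cvg_lim _ fl).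
apply: DeriveDef; first by apply/cvg_ex; exists d.
exact: cvg_lim fd.
Qed.

(** The two difference quotients coincide. This transfers the one-variable chain rule and mean value
    theorem to directional derivatives. *)
Lemma is_derive_line (V W : normedModType R) (f : V -> W) x v (t : R) d :
  is_derive (t *: v + x) v f d <-> is_derive t 1 (fun s : R => f (s *: v + x)) d.
Proof.
rewrite !is_deriveP.
suff -> : (fun h : R => h^-1 *: (f (h *: v + (t *: v + x)) - f (t *: v + x))) =
  (fun h : R => h^-1 *: (f ((h *: 1 + t) *: v + x) - f (t *: v + x))) by [].
by apply/funext => h; rewrite addrA -scalerDl [h *: 1]mulr1.
Qed.

Lemma is_derive_line0 (V W : normedModType R) (f : V -> W) x v d :
  is_derive x v f d <-> is_derive (0 : R) 1 (fun s : R => f (s *: v + x)) d.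
Proof. by rewrite -is_derive_line scale0r add0r. Qed.

Lemma is_derive_scaled (V : normedModType R) (f : V -> R) x v (k d : R) :
  is_derive x v f d -> is_derive x (k *: v) f (k * d).
Proof.
move=> /is_derive_line0 fd; apply/is_derive_line0.
have -> : (fun s : R => f (s *: (k *: v) + x)) =
    (fun s : R => f (s *: v + x)) \o (fun s => s * k).
  by apply/funext => s /=; rewrite scalerA.
rewrite mulrC; apply: is_derive1_comp; first by rewrite mul0r.
have := @is_deriveM R _ _ _ _ _ _ _ (is_derive_id (0 : R) 1) (is_derive_cst k (0 : R) 1).
by rewrite scaler0 add0r [_ *: _]mulr1.
Qed.

(** Along [v], the composite with an affine map has the difference quotient of [f] along [T v]. *)
Lemma is_derive_mulmx m n (T : 'M[R]_(m, n)) (c : 'cV[R]_m) (f : 'cV[R]_m -> R) x v d :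
  is_derive (T *m x + c) (T *m v) f d ->
  is_derive x v (fun y : 'cV[R]_n => f (T *m y + c)) d.
Proof.
rewrite !is_deriveP.
suff -> : (fun h : R => h^-1 *: (f (h *: (T *m v) + (T *m x + c)) - f (T *m x + c))) =
  (fun h : R => h^-1 *: (f (T *m (h *: v + x) + c) - f (T *m x + c))) by [].
by apply/funext => h; rewrite mulmxDr scalemxAr addrA.
Qed.

Lemma is_derive_ln (V : normedModType R) (f : V -> R) x v (d : R) : 0 < f x ->
  is_derive x v f d -> is_derive x v (fun y => ln (f y)) ((f x)^-1 * d).
Proof.
move=> fx0 /is_derive_line0 fd; apply/is_derive_line0.
pose g (s : R) := f (s *: v + x).
have g0 : g 0 = f x by rewrite /g scale0r add0r.
rewrite -g0 in fx0 *; exact: (is_derive1_comp (is_derive1_ln fx0) fd).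
Qed.

(** The increment along [u + w] splits into one along [w] from [x] and one along [u] from the moved
    point [h w + x]. By the mean value theorem the latter, divided by [h], is a value of ['D_u f]
    near [x], and continuity gives the limit. *)
Lemma is_derive_add_direction (V : normedModType R) (f : V -> R) x u w (d : R) :
  (forall y, derivable f y u) -> {for x, continuous ('D_u f)} ->
  is_derive x w f d -> is_derive x (u + w) f ('D_u f x + d).
Proof.
move=> fu cu; rewrite !is_deriveP => fw.
have -> : (fun h : R => h^-1 *: (f (h *: (u + w) + x) - f x)) =
    (fun h : R => h^-1 *: (f (h *: u + (h *: w + x)) - f (h *: w + x))) \+
    (fun h : R => h^-1 *: (f (h *: w + x) - f x)).
  apply/funext => h /=.
  by rewrite [h *: (u + w)]scalerDr -[in LHS]addrA -[RHS]scalerDr [X in _ = _ *: X]addrA subrK.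
apply: cvgD => //.
(* Negative [h] is treated by exchanging the endpoints of the segment. *)
have mvt (h : R) y : h != 0 -> exists2 c : R, `|c| <= `|h| &
    h^-1 *: (f (h *: u + y) - f y) = 'D_u f (c *: u + y).
  have der (t : R) : is_derive t 1 (fun s : R => f (s *: u + y)) ('D_u f (t *: u + y)).
    by apply/(is_derive_line f y u t); exact: derivableP (fu _).
  have mvt_pos (a b : R) : a <= b -> exists2 c, c \in `[a, b] &
      f (b *: u + y) - f (a *: u + y) = 'D_u f (c *: u + y) * (b - a).
    move=> ab; apply: (MVT_segment ab (fun t _ => der t)).
    apply/continuous_subspaceT => t.
    exact/differentiable_continuous/derivable1_diffP.
  move=> h0; have [hpos|hneg] := leP 0 h.
    have [c] := mvt_pos _ _ hpos; rewrite in_itv/= => /andP[c0 ch].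
    rewrite scale0r add0r subr0 => fE; exists c; first by rewrite !ger0_norm.
    by rewrite fE -[LHS]/(h^-1 * _) mulrC mulfK.
  have [c] := mvt_pos _ _ (ltW hneg); rewrite in_itv/= => /andP[hc c0].
  rewrite scale0r add0r sub0r => fE; exists c; first by rewrite !ler0_norm ?lerN2// ltW.
  by rewrite -opprB fE mulrN opprK -[LHS]/(h^-1 * _) mulrC mulfK.
apply/cvgrPdist_lt => e e0.
have [r /= r0 fr] : exists2 r, 0 < r & forall y, `|y - x| < r -> `|'D_u f x - 'D_u f y| < e.
  have /cvgrPdist_lt/(_ _ e0)/nbhs_normP[r /= r0 fr] := cu.
  by exists r => // y yx; apply: fr; rewrite /= distrC.
(* The summand 1 keeps this bound positive, hence a valid divisor, even if [u = w = 0]. *)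
have uw0 : 0 < `|u| + `|w| + 1 by rewrite ltr_wpDl// addr_ge0.
near=> h.
have [|c ch ->] := mvt h (h *: w + x); first by near: h; exact: nbhs_dnbhs_neq.
apply: fr; rewrite addrA addrK (le_lt_trans (ler_normD _ _))// !normrZ.
apply: (@le_lt_trans _ _ (`|h| * (`|u| + `|w| + 1))).
  by rewrite !mulrDr mulr1 -addrA lerD ?ler_wpM2r// ler_wpDr.
rewrite -ltr_pdivlMr//; near: h.
apply: dnbhs0_lt; exact: divr_gt0.
Unshelve. all: by end_near. Qed.

Lemma col_sum_delta n (v : 'cV[R]_n) : v = \sum_i v i ord0 *: delta_mx i ord0.
Proof.
rewrite {1}[v]matrix_sum_delta; apply: eq_bigr => i _.
by rewrite big_ord_recl big_ord0 addr0.
Qed.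

(** Continuity of the partial derivatives allows the coordinate components of [v] to be added to the
    direction one at a time. *)
Lemma is_derive_gradient n (f : 'cV[R]_n -> R) x v :
  (forall i y, derivable f y (delta_mx i ord0)) ->
  (forall i, continuous (partial i f)) ->
  is_derive x v f ((v^T *m gradient f x) ord0 ord0).
Proof.
move=> df cf.
suff : forall s : seq 'I_n, is_derive x (\sum_(i <- s) v i ord0 *: delta_mx i ord0) f
    (\sum_(i <- s) v i ord0 * partial i f x).
  move=> /(_ (index_enum _)); rewrite -col_sum_delta.
  have -> // : (v^T *m gradient f x) ord0 ord0 = \sum_i v i ord0 * partial i f x.
  by rewrite mxE; apply: eq_bigr => i _; rewrite !mxE.
elim=> [|i s IH].
  rewrite !big_nil; apply: DeriveDef; first exact: derivable0.
  exact: derive0.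
rewrite !big_cons.
have dE y : is_derive y (v i ord0 *: delta_mx i ord0) f (v i ord0 * partial i f y).
  by apply: is_derive_scaled; apply/derivableP/df.
have <- : 'D_(v i ord0 *: delta_mx i ord0) f x = v i ord0 * partial i f x.
  exact: derive_val.
apply: is_derive_add_direction => //.
rewrite (_ : 'D_(_) f = fun y => v i ord0 * partial i f y).
  by apply: continuousM; [exact: cst_continuous|exact: cf].
by apply/funext => y; exact: derive_val.
Qed.

(** Any two points are joined by a path of segments parallel to the axes, and [f] is constant on
    each. *)
Lemma partial_eq0_cst n (f : 'cV[R]_n -> R) :
  (forall i x, is_derive x (delta_mx i ord0) f 0) -> forall x y, f x = f y.
Proof.
move=> df x y.
have line i (t : R) z : f (t *: delta_mx i ord0 + z) = f z.
  have -> : f z = f (0 *: delta_mx i ord0 + z) by rewrite scale0r add0r.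
  apply: (is_derive_0_is_cst (f := fun s => f (s *: delta_mx i ord0 + z))) => s.
  by apply/(is_derive_line f z (delta_mx i ord0) s); exact: df.
have sumline (s : seq 'I_n) (v : 'cV[R]_n) z :
    f (\sum_(i <- s) v i ord0 *: delta_mx i ord0 + z) = f z.
  elim: s => [|i s IH]; first by rewrite big_nil add0r.
  by rewrite big_cons -addrA line.
by rewrite -[x](subrK y) [x - y]col_sum_delta sumline.
Qed.

End directional_derivatives.

(** * Integrals of the transition density *)

Section affine_change_of_variables.
Context {R : realType} (n : nat).
Local Notation mu := (@lebesgue_cV R n).
Local Open Scope ereal_scope.

(** The pushforward of [mu] under the affine map is [mu] scaled by [|det M|^-1]. *)
Lemma ge0_integral_affine (M : 'M[R]_n) (c : 'cV[R]_n) (f : 'cV[R]_n -> \bar R) :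
  M \in unitmx -> measurable_fun setT f -> (forall x, 0 <= f x) ->
  \int[mu]_x f (M *m x + c)%R = (`|\det M|^-1)%R%:E * \int[mu]_x f x.
Proof.
move=> Mu mf f0; have k0 : (0 <= `|\det M|^-1)%R by rewrite invr_ge0.
pose m := mscale (NngNum k0) mu.
have maff := measurable_affine M c.
rewrite -[LHS](@ge0_integral_pushforward _ _ _ _ _ _ maff mu setT f)//.
rewrite (@eq_measure_integral _ _ _ setT m) => [|A mA _].
  by rewrite ge0_integral_mscale.
exact: lebesgue_cV_affine.
Qed.

Lemma integral_affine (M : 'M[R]_n) (c : 'cV[R]_n) (f : 'cV[R]_n -> \bar R) :
  M \in unitmx -> mu.-integrable setT f ->
  \int[mu]_x f (M *m x + c)%R = (`|\det M|^-1)%R%:E * \int[mu]_x f x.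
Proof.
move=> Mu intf; have mf := measurable_int _ intf.
rewrite [LHS]integralE [X in _ = _ * X]integralE [RHS]muleBr//; last first.
  exact/fin_num_adde_defr/integrable_pos_fin_num.
congr (_ - _).
  rewrite -(ge0_integral_affine c)//; last exact: measurable_funepos.
  by under eq_integral do rewrite funepos_comp.
rewrite -(ge0_integral_affine c)//; last exact: measurable_funeneg.
by under eq_integral do rewrite funeneg_comp.
Qed.

End affine_change_of_variables.

Section density.
Context {R : realType} (n : nat) (phi : 'cV[R]_n -> R).
Hypothesis phiP : base_density phi.
Local Notation mu := (@lebesgue_cV R n).

Lemma base_density_measurable : measurable_fun setT phi.
Proof.
by apply: continuous_measurable_cV; have [] := base_density_C2 phiP.
Qed.

Lemma measurable_sqnorm2 : measurable_fun setT (@sqnorm2 R n).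
Proof.
apply: measurable_sum => i; apply: measurable_funX; exact: measurable_cV_coord.
Qed.

Lemma base_density_integrable : mu.-integrable setT (EFin \o phi).
Proof.
apply/integrableP; split.
  by apply/measurable_EFinP; exact: base_density_measurable.
rewrite (eq_integral (EFin \o phi)) => [|w _]; last first.
  by rewrite gee0_abs// lee_fin ltW// (base_density_gt0 phiP).
by rewrite (base_density_int1 phiP) ltry.
Qed.

(** A coordinate is bounded by the Euclidean norm, so the finite first moment dominates. *)
Lemma base_density_moment_integrable i :
  mu.-integrable setT (fun w => (w i ord0 * phi w)%:E).
Proof.
have phi0 w := ltW (base_density_gt0 phiP w).
have mphi := base_density_measurable.
apply: (@le_integrable _ _ _ _ _ measurableT _
  (fun w => (Num.sqrt (sqnorm2 w) * phi w)%:E)).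
- apply/measurable_EFinP; apply: measurable_funM => //.
  exact: measurable_cV_coord.
- move=> w _; rewrite !abse_EFin lee_fin !normrM ler_wpM2r//.
  rewrite [leRHS]ger0_norm ?sqrtr_ge0// -sqrtr_sqr ler_wsqrtr// /sqnorm2 (bigD1 i)//=.
  by rewrite lerDl sumr_ge0// => j _; exact: sqr_ge0.
- apply/integrableP; split.
    apply/measurable_EFinP; apply: measurable_funM => //.
    apply: measurableT_comp; last exact: measurable_sqnorm2.
    by apply: continuous_measurable_fun; exact: sqrt_continuous.
  rewrite (eq_integral (fun w => (Num.sqrt (sqnorm2 w) * phi w)%:E)) => [|w _].
    exact: base_density_moment1 phiP.
  by rewrite gee0_abs// lee_fin mulr_ge0.
Qed.

Section posdef_covariance.
Context (A S : 'M[R]_n) (Sp : posdefmx S).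
Local Notation Q := (sqrtmx S).

Lemma sqrtmx_unit : Q \in unitmx.
Proof. by have [Qp _] := sqrtmxP Sp; exact: posdefmx_unit. Qed.

Lemma sqrt_det : Num.sqrt (\det S) = `|\det Q|.
Proof. by have [_ {1}<-] := sqrtmxP Sp; rewrite det_mulmx -expr2 sqrtr_sqr. Qed.

Lemma sqrt_det_gt0 : 0 < Num.sqrt (\det S).
Proof. by rewrite sqrt_det normr_gt0 -unitfE -unitmxE sqrtmx_unit. Qed.

Lemma transition_density_affine y x : transition_density phi (A, S) y x =
  (Num.sqrt (\det S))^-1 * phi (invmx Q *m y + - (invmx Q *m (A *m x))).
Proof. by rewrite /transition_density /= mulmxBr. Qed.

Lemma transition_density_gt0 y x : 0 < transition_density phi (A, S) y x.
Proof. by rewrite mulr_gt0 ?invr_gt0 ?sqrt_det_gt0 ?(base_density_gt0 phiP). Qed.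

Local Open Scope ereal_scope.

Lemma det_invmx_sqrt : (`|\det (invmx Q)|^-1 = Num.sqrt (\det S))%R.
Proof. by rewrite sqrt_det det_inv normfV invrK. Qed.

Lemma transition_density_int1 x :
  \int[mu]_y (transition_density phi (A, S) y x)%:E = 1.
Proof.
under eq_integral do rewrite transition_density_affine EFinM.
have mphi := base_density_measurable.
have phi0 w : 0 <= (phi w)%:E by rewrite lee_fin ltW// (base_density_gt0 phiP).
pose c := (- (invmx Q *m (A *m x)))%R.
rewrite ge0_integralZl//; last first.
  by apply/measurable_EFinP; apply: measurableT_comp => //; exact: measurable_affine.
rewrite (@ge0_integral_affine _ _ _ c (EFin \o phi))//; last 2 first.
- by rewrite unitmx_inv sqrtmx_unit.
- exact/measurable_EFinP.
rewrite (base_density_int1 phiP) mule1 det_invmx_sqrt -EFinM mulVf//.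
by rewrite gt_eqF// sqrt_det_gt0.
Qed.

(** Substitute [y = Q w + A x]: the noise term has mean zero and the constant term remains. *)
Lemma transition_density_mean x i :
  \int[mu]_y (y i ord0 * transition_density phi (A, S) y x)%:E =
  ((A *m x) i ord0)%:E.
Proof.
have d0 := sqrt_det_gt0.
pose c := (- (invmx Q *m (A *m x)))%R.
(* The integrand in the variable [w], expanded into the moments of [phi]. *)
pose h (w : 'cV[R]_n) : \bar R :=
  \sum_(j < n) ((Num.sqrt (\det S))^-1 * Q i j)%:E * (w j ord0 * phi w)%:E
  + ((Num.sqrt (\det S))^-1 * (A *m x) i ord0)%:E * (phi w)%:E.
have int1 j := integrableZl measurableT ((Num.sqrt (\det S))^-1 * Q i j)
  (base_density_moment_integrable j).
have int2 := integrableZl measurableT ((Num.sqrt (\det S))^-1 * (A *m x) i ord0)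
  base_density_integrable.
have inth : mu.-integrable setT h.
  by apply: integrableD => //; exact: integrable_sum.
transitivity (\int[mu]_y h (invmx Q *m y + c)%R).
  apply: eq_integral => y _; rewrite /h transition_density_affine -/c.
  set w := (invmx Q *m y + c)%R.
  have -> : y = (Q *m w + A *m x)%R.
    by rewrite mulmxDr mulmxN !mulKVmx ?sqrtmx_unit// subrK.
  under eq_bigr do rewrite -EFinM.
  rewrite sumEFin -EFinM -EFinD; congr EFin.
  rewrite !mxE mulrDl mulr_suml; congr (_ + _)%R; last by ring.
  by apply: eq_bigr => j _; ring.
rewrite integral_affine ?unitmx_inv ?sqrtmx_unit// det_invmx_sqrt.
rewrite integralD//; last exact: integrable_sum.
rewrite integral_sum// big1 => [|j _]; last first.
  by rewrite integralZl ?(base_density_mean phiP) ?mule0//; exact: base_density_moment_integrable.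
rewrite add0e integralZl//; last exact: base_density_integrable.
rewrite (base_density_int1 phiP) mule1 -EFinM mulrA divff ?mul1r//.
by rewrite gt_eqF.
Qed.

End posdef_covariance.
End density.

(** * The score *)

Lemma continuous_sum (R : realType) (T : topologicalType) (I : Type) (s : seq I)
    (F : I -> T -> R) :
  (forall i, continuous (F i)) -> continuous (fun x => \sum_(i <- s) F i x).
Proof.
move=> cF; elim: s => [|i s IH].
  rewrite (_ : (fun _ => _) = fun=> 0); first exact: cst_continuous.
  by apply/funext => x; rewrite big_nil.
rewrite (_ : (fun _ => _) = fun x => F i x + \sum_(j <- s) F j x).
  by move=> x; apply: continuousD; [exact: cF|exact: IH].
by apply/funext => x; rewrite big_cons.
Qed.

Lemma continuous_cV (R : realType) (T : topologicalType) n (f : T -> 'cV[R]_n) :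
  (forall i, continuous (fun x => f x i ord0)) -> continuous f.
Proof.
move=> cf x B [P nP PB].
have : \forall y \near x, forall i, P i ord0 (f y i ord0).
  by apply: filter_forall => i; exact: cf (nP i ord0).
by apply: filterS => y Py; apply: PB => i j; rewrite ord1.
Qed.

Lemma continuous_affine (R : realType) m n (M : 'M[R]_(m, n)) (c : 'cV[R]_m) :
  continuous (fun x : 'cV[R]_n => M *m x + c).
Proof.
apply: continuous_cV => i.
rewrite (_ : (fun _ => _) =
    fun x : 'cV[R]_n => \sum_j (M i j * x j ord0) + c i ord0); last first.
  by apply/funext => x; rewrite !mxE.
move=> x; apply: continuousD; last exact: cst_continuous.
apply: (continuous_sum (F := fun j (x : 'cV[R]_n) => M i j * x j ord0)) => j y.
by apply: continuousM; [exact: cst_continuous|exact: coord_continuous].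
Qed.

Section score.
Context {R : realType} (n : nat) (phi : 'cV[R]_n -> R).
Hypothesis phiP : base_density phi.
Local Notation mu := (@lebesgue_cV R n).

(** The derivative of [ln phi] at [w] in the direction [v]. *)
Definition log_slope (v w : 'cV[R]_n) : R :=
  (phi w)^-1 * (v^T *m gradient phi w) ord0 ord0.

Lemma log_slope_continuous v : continuous (log_slope v).
Proof.
have [cphi _ dphi _ _] := base_density_C2 phiP.
rewrite (_ : log_slope v =
    fun w => (phi w)^-1 * \sum_i v i ord0 * partial i phi w); last first.
  by apply/funext => w; rewrite /log_slope mxE; congr (_ * _);
    apply: eq_bigr => i _; rewrite !mxE.
move=> w; apply: (@continuousM _ _ (fun w => (phi w)^-1)
  (fun w => \sum_i v i ord0 * partial i phi w)).
  by apply: continuousV; [rewrite gt_eqF// (base_density_gt0 phiP)|exact: cphi].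
apply: (continuous_sum (F := fun i w => v i ord0 * partial i phi w)) => i y.
by apply: continuousM; [exact: cst_continuous|exact: dphi].
Qed.

Section posdef_covariance.
Context (A S : 'M[R]_n) (Sp : posdefmx S).
Local Notation Ti := (invmx (sqrtmx S)).

(** The log-density is a constant plus [ln phi] of an affine function of [y], so the direction is
    carried through the linear part. *)
Lemma is_derive_log_transition_density x y i :
  is_derive y (delta_mx i ord0) (fun y => ln (transition_density phi (A, S) y x))
    (log_slope (Ti *m delta_mx i ord0) (Ti *m y + - (Ti *m (A *m x)))).
Proof.
have [_ dphi cphi _ _] := base_density_C2 phiP.
set c := - (Ti *m (A *m x)).
have k0 : 0 < (Num.sqrt (\det S))^-1 by rewrite invr_gt0 sqrt_det_gt0.
have -> : (fun y => ln (transition_density phi (A, S) y x)) =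
    (fun=> ln (Num.sqrt (\det S))^-1) + (fun y => ln (phi (Ti *m y + c))).
  by apply/funext => z; rewrite transition_density_affine lnM// posrE// (base_density_gt0 phiP).
rewrite -[X in is_derive _ _ _ X]add0r; apply: is_deriveD.
apply: is_derive_ln; first exact: base_density_gt0.
by apply: is_derive_mulmx; exact: is_derive_gradient.
Qed.

Lemma scoreE x y i : score phi (A, S) y x i ord0 =
  log_slope (Ti *m delta_mx i ord0) (Ti *m y + - (Ti *m (A *m x))).
Proof. by rewrite mxE; case: (is_derive_log_transition_density x y i). Qed.

Lemma score_continuous x i : continuous (fun y => score phi (A, S) y x i ord0).
Proof.
under eq_fun do rewrite scoreE.
move=> y; apply: (@continuous_comp _ _ _ (fun y => Ti *m y + - (Ti *m (A *m x)))).
  exact: continuous_affine.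
exact: log_slope_continuous.
Qed.

Lemma measurable_standardized_innovation :
  measurable_fun [set: 'cV[R]_n * 'cV[R]_n]
    (fun z => Ti *m z.2 + - (Ti *m (A *m z.1))).
Proof.
apply: measurable_cVP => i.
rewrite (_ : (fun _ => _) = ((fun x : 'cV[R]_n => (Ti *m x + 0) i ord0) \o snd) \-
    ((fun x : 'cV[R]_n => (Ti *m A *m x + 0) i ord0) \o fst)); last first.
  by apply/funext => -[x y] /=; rewrite !addr0 -mulmxA !mxE.
have mc (M : 'M[R]_n) : measurable_fun setT (fun x : 'cV[R]_n => (M *m x + 0) i ord0).
  exact: (measurableT_comp (measurable_cV_coord i) (measurable_affine M 0)).
by apply: measurable_funB; apply: measurableT_comp.
Qed.

Lemma measurable_score i : measurable_fun [set: 'cV[R]_n * 'cV[R]_n]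
  (fun z => score phi (A, S) z.2 z.1 i ord0).
Proof.
under eq_fun do rewrite scoreE.
apply: (measurableT_comp _ measurable_standardized_innovation).
by apply: continuous_measurable_cV; exact: log_slope_continuous.
Qed.

Lemma measurable_transition_density : measurable_fun [set: 'cV[R]_n * 'cV[R]_n]
  (fun z => transition_density phi (A, S) z.2 z.1).
Proof.
under eq_fun do rewrite transition_density_affine.
apply: measurable_funM => //.
apply: (measurableT_comp _ measurable_standardized_innovation).
exact: base_density_measurable.
Qed.

End posdef_covariance.

Section score_eq.
Context (A1 A2 S1 S2 : 'M[R]_n) (S1p : posdefmx S1) (S2p : posdefmx S2).
Context (x : 'cV[R]_n).
Hypothesis eq_score : forall y, score phi (A1, S1) y x = score phi (A2, S2) y x.

Lemma score_eq_transition_density y :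
  transition_density phi (A1, S1) y x = transition_density phi (A2, S2) y x.
Proof.
pose f1 z := transition_density phi (A1, S1) z x.
pose f2 z := transition_density phi (A2, S2) z x.
have f1_gt0 z : 0 < f1 z by exact: transition_density_gt0.
have f2_gt0 z : 0 < f2 z by exact: transition_density_gt0.
(* Equal scores make the ratio of the two densities constant in the next state; [k] is its value at
   0. Integrating both sides then forces [k = 1]. *)
pose k := expR (ln (f1 0) - ln (f2 0)).
have f12 z : f1 z = k * f2 z.
  rewrite /k (partial_eq0_cst (f := fun y => ln (f1 y) - ln (f2 y)) _ 0 z).
    by rewrite expRD expRN !lnK ?posrE// divfK// gt_eqF.
  move=> i w; have d1 := is_derive_log_transition_density A1 S1p x w i.
  have d2 := is_derive_log_transition_density A2 S2p x w i.
  have := is_deriveB d1 d2.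
  by rewrite -!scoreE// eq_score subrr.
suff k1 : k = 1 by rewrite -[LHS]/(f1 y) f12 k1 mul1r.
have := transition_density_int1 phiP A1 S1p x.
under eq_integral do rewrite -[transition_density _ _ _ _]/(f1 _) f12 EFinM.
rewrite ge0_integralZl//; last 3 first.
- apply/measurable_EFinP.
  apply: (measurableT_comp (g := pair x)
    (f := fun z => transition_density phi (A2, S2) z.2 z.1)).
    exact: measurable_transition_density.
  exact: pair1_measurable.
- by move=> z _; rewrite lee_fin ltW.
- by rewrite lee_fin expR_ge0.
by rewrite (transition_density_int1 phiP A2 S2p x) mule1 => -[].
Qed.

Lemma score_eq_mean : A1 *m x = A2 *m x.
Proof.
apply/colP => i; apply: EFin_inj.
rewrite -(transition_density_mean phiP A1 S1p) -(transition_density_mean phiP A2 S2p).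
by apply: eq_integral => y _; rewrite score_eq_transition_density.
Qed.

End score_eq.
End score.

(** * Parameters with zero loss *)

Lemma hyperplane_negligible (R : realType) n (b : 'rV[R]_n) : b != 0 ->
  (lebesgue_cV n).-negligible [set x | b *m x = 0].
Proof.
move=> b0; suff mH : measurable [set x : 'cV[R]_n | b *m x = 0].
  by apply/(negligibleP _ mH); exact: lebesgue_cV_hyperplane.
have -> : [set x : 'cV[R]_n | b *m x = 0] =
    (fun x : 'cV[R]_n => (b *m x + 0) ord0 ord0) @^-1` [set 0].
  apply/seteqP; split=> x /=; rewrite addr0; first by move=> ->; rewrite mxE.
  by move=> bx; rewrite [LHS]mx11_scalar bx raddf0.
rewrite -[X in measurable X]setTI.
exact: (measurableT_comp (measurable_cV_coord ord0) (measurable_affine b 0)).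
Qed.

(** Moving the state from [x] to [x0] is compensated by a shift of the next state that preserves the
    innovation [y - A x]. *)
Lemma transition_density_translation (R : realType) n (phi : 'cV[R]_n -> R)
    (A S : 'M[R]_n) (x x0 y : 'cV[R]_n) :
  transition_density phi (A, S) y x =
  transition_density phi (A, S) (y - A *m x + A *m x0) x0.
Proof. by rewrite /transition_density /= addrK. Qed.

Section transition_law.
Context {R : realType} (n : nat) (phi : 'cV[R]_n -> R).
Hypothesis phiP : base_density phi.
Context (As Ss : 'M[R]_n) (Ssp : posdefmx Ss).
Context (dD : probability ('cV[R]_n * 'cV[R]_n)%type R) (p : 'cV[R]_n -> R).
Hypothesis dDP : transition_law phi (As, Ss) dD p.
Local Notation mu := (@lebesgue_cV R n).

(** By the density of the law, [dD N] is the integral of [p x] times the mass of the section under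
    the positive density [f]. If it vanishes, almost every section with [p x != 0] is Lebesgue null,
    and an open null set is empty. *)
Lemma transition_law_null_sections (N : set ('cV[R]_n * 'cV[R]_n)) :
  measurable N -> (forall x, open (xsection N x)) -> dD N = 0%E ->
  mu.-negligible [set x | p x != 0 /\ xsection N x !=set0].
Proof.
move=> mN oN N0.
pose f z := transition_density phi (As, Ss) z.2 z.1.
pose g z : \bar R := (f z * \1_N z)%:E.
have f_gt0 z : 0 < f z by exact: transition_density_gt0.
have g_ge0 z : (0 <= g z)%E by rewrite lee_fin mulr_ge0// ltW.
have mf : measurable_fun setT f by exact: measurable_transition_density.
have mg : measurable_fun setT g.
  by apply/measurable_EFinP; apply: measurable_funM => //; exact: measurable_indic.
have mpair x : measurable_fun setT (fun y : 'cV[R]_n => g (x, y)).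
  by apply: measurableT_comp => //; exact: pair1_measurable.
pose F := fubini_F mu g.
have F_ge0 x : (0 <= F x)%E by apply: integral_ge0.
have mF : measurable_fun setT F by exact: measurable_fun_fubini_tonelli_F.
have mpF : measurable_fun setT (fun x => (p x)%:E * F x)%E.
  apply: emeasurable_funM => //; apply/measurable_EFinP.
  exact: state_density_measurable dDP.
have pF0 : (\int[mu]_x `|(p x)%:E * F x| = 0)%E.
  rewrite -N0 (next_state_law dDP mN); apply: eq_integral => x _.
  rewrite gee0_abs ?mule_ge0// ?lee_fin ?(state_density_ge0 dDP)//; congr (_ * _)%E.
  rewrite [RHS]integral_mkcond; apply: eq_integral => y _.
  rewrite /g /f patchE /= indicE mem_xsection.
  by case: ifP; rewrite (mulr1, mulr0).
move/(ae_eq_integral_abs _ measurableT mpF) : pF0; apply: negligibleS.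
move=> x [px0 [y Ny]] /= /(_ I)/eqP; rewrite mule_eq0 eqe (negbTE px0)/= => /eqP Fx0.
have : (\int[mu]_y `|g (x, y)| = 0)%E.
  by rewrite -Fx0; apply: eq_integral => z _; rewrite gee0_abs.
move/(ae_eq_integral_abs _ measurableT (mpair x)) => g0.
have : mu.-negligible (xsection N x).
  apply: negligibleS g0 => z; rewrite /xsection/= => Nz /(_ I)/eqP.
  rewrite eqe /g indicE Nz mulr1 gt_eqF//.
move/(negligibleP _ (measurable_xsection x mN)).
by have := lebesgue_cV_open_gt0 (oN x) (ex_intro _ y Ny) => /[swap] ->; rewrite ltxx.
Qed.

(** Otherwise [p] would integrate to 0, while its integral is the total mass 1. *)
Lemma state_density_not_negligible : ~ mu.-negligible [set x | p x != 0].
Proof.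
move=> p0.
have mp := state_density_measurable dDP.
have : (\int[mu]_x `|(p x)%:E| = 0)%E.
  apply/(ae_eq_integral_abs _ measurableT); first exact/measurable_EFinP.
  apply: negligibleS p0 => x /= px; apply/eqP => px0; apply: px => _.
  by rewrite px0.
under eq_integral do rewrite gee0_abs ?lee_fin ?(state_density_ge0 dDP)//.
rewrite -(state_density_law dDP measurableT) setXTT probability_setT => /eqP.
by rewrite onee_eq0.
Qed.

Section minimizer.
Context (A S : 'M[R]_n) (Sp : posdefmx S).
Hypothesis loss0 : sme_loss phi dD (As, Ss) (A, S) = 0%E.

Lemma sme_loss0_negligible :
  mu.-negligible [set x | p x != 0 /\
    exists y, score phi (A, S) y x != score phi (As, Ss) y x].
Proof.
pose D z := sqnorm2 (score phi (A, S) z.2 z.1 - score phi (As, Ss) z.2 z.1).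
have DE x y : D (x, y) =
    \sum_i (score phi (A, S) y x i ord0 - score phi (As, Ss) y x i ord0) ^+ 2.
  by apply: eq_bigr => i _; rewrite mxE [X in _ + X]mxE.
have mD : measurable_fun setT D.
  rewrite (_ : D = fun z => \sum_i (score phi (A, S) z.2 z.1 i ord0 -
      score phi (As, Ss) z.2 z.1 i ord0) ^+ 2); last first.
    by apply/funext => -[x y]; exact: DE.
  apply: measurable_sum => i; apply: measurable_funX; apply: measurable_funB;
    exact: measurable_score.
have D_eq0 x y : D (x, y) = 0 -> score phi (A, S) y x = score phi (As, Ss) y x.
  rewrite /D /sqnorm2 -sqnormE => /trmx_mul_self_eq0/eqP; rewrite subr_eq0 => /eqP h.
  exact: h.
(* Zero loss makes this set null for [dD]. Its sections are open because the scores are continuous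
   in the next state, so almost everywhere equality becomes equality for all next states. *)
pose N := D @^-1` [set~ 0].
have mN : measurable N.
  by rewrite -[N]setTI; apply: mD => //; exact: measurableC.
have oN x : open (xsection N x).
  have -> : xsection N x = (fun y => D (x, y)) @^-1` [set~ 0].
    by apply/seteqP; split=> y; rewrite /xsection/= inE.
  apply: open_comp => [y _|]; last by apply: closed_openC; exact: closed_eq.
  under eq_fun do rewrite DE.
  apply: (continuous_sum (F := fun i y => (score phi (A, S) y x i ord0 -
      score phi (As, Ss) y x i ord0) ^+ 2)) => i z.
  pose s y := score phi (A, S) y x i ord0 - score phi (As, Ss) y x i ord0.
  apply: (@continuous_comp _ _ _ s (fun t : R => t ^+ 2)); last exact: exprn_continuous.
  by apply: continuousB; exact: score_continuous.
have N0 : dD N = 0%E.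
  apply/negligibleP => //.
  have : (\int[dD]_z `|(D z)%:E| = 0)%E.
    rewrite -loss0 /sme_loss unlock; apply: eq_integral => z _.
    by rewrite gee0_abs// lee_fin sumr_ge0// => i _; exact: sqr_ge0.
  move/(ae_eq_integral_abs _ measurableT); rewrite measurable_EFinP => /(_ mD).
  by apply: negligibleS => z Dz /= /(_ I) [].
apply: negligibleS (transition_law_null_sections mN oN N0) => x [px [y xy]].
split=> //; exists y; rewrite /xsection/= inE => /D_eq0/eqP.
exact/negP.
Qed.

Lemma sme_loss0_mean : A = As.
Proof.
apply/eqP; rewrite -subr_eq0; apply: contraT => A0; exfalso.
apply: state_density_not_negligible.
(* If [A != As], some row of [A - As] is nonzero. Almost every [x] with [p x != 0] satisfies
   [A x = As x], hence lies in the null hyperplane of that row. *)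
have [i Ai] : exists i, row i (A - As) != 0.
  apply/existsP; apply: contraNT A0; rewrite negb_exists => /forallP Ai.
  by apply/eqP/row_matrixP => i; rewrite row0; apply/eqP; rewrite -[_ == _]negbK.
have null : mu.-negligible [set x | row i (A - As) *m x = 0].
  exact: hyperplane_negligible.
apply: negligibleS (negligibleU sme_loss0_negligible null) => x /= px.
have [[y xy]|/forallNP xy] :=
    pselect (exists y, score phi (A, S) y x != score phi (As, Ss) y x).
  by left; split=> //; exists y.
have eq_score y : score phi (A, S) y x = score phi (As, Ss) y x.
  by apply/eqP; have /negP := xy y; rewrite negbK.
by right; rewrite /= -row_mul mulmxBl (score_eq_mean phiP Sp Ssp eq_score) subrr row0.
Qed.

Lemma sme_loss0_transition_density y x :
  transition_density phi (A, S) y x = transition_density phi (As, Ss) y x.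
Proof.
(* One state with equal scores is enough; it exists because the set where [p] is nonzero is not
   negligible. *)
have [x0 [px0 xy]] : exists x0, p x0 != 0 /\
    forall y, score phi (A, S) y x0 = score phi (As, Ss) y x0.
  apply: contrapT => /forallNP noX; apply: state_density_not_negligible.
  apply: negligibleS sme_loss0_negligible => x0 px0; split; first exact: px0.
  apply: contrapT => /forallNP xy; apply: (noX x0); split; first exact: px0.
  move=> z.
  by apply/eqP; have /negP := xy z; rewrite negbK.
(* Both densities are moved to the state [x0]; as [A = As], the shifted next states coincide. *)
rewrite (transition_density_translation _ _ _ x x0).
rewrite (transition_density_translation _ As _ x x0) -sme_loss0_mean.
have tdE := score_eq_transition_density phiP Sp Ssp xy.
by rewrite tdE sme_loss0_mean.
Qed.

End minimizer.
End transition_law.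

Unset Implicit Arguments.

Theorem lemma6 (R : realType) (d : nat)
    (phi : 'cV[R]_d -> R) (hphi : base_density phi)
    (ThetaA ThetaS : set 'M[R]_d) (hThetaS : ThetaS `<=` posdefmx)
    (As Ss : 'M[R]_d)
    (hint : interior_in [set th : 'M[R]_d * 'M[R]_d | th.2^T = th.2]
              (ThetaA `*` ThetaS) (As, Ss))
    (hident : forall th1 th2 : 'M[R]_d * 'M[R]_d,
       (ThetaA `*` ThetaS) th1 -> (ThetaA `*` ThetaS) th2 ->
       (forall x x' : 'cV[R]_d,
          transition_density phi th1 x' x = transition_density phi th2 x' x)
       <-> th1 = th2)
    (dD : probability ('cV[R]_d * 'cV[R]_d)%type R) (p : 'cV[R]_d -> R)
    (hdD : transition_law phi (As, Ss) dD p) :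
  unique_minimizer (ThetaA `*` ThetaS) (sme_loss phi dD (As, Ss)) (As, Ss).
Proof.
have Xs : (ThetaA `*` ThetaS) (As, Ss).
  (* An interior point belongs to the set: [Ss] is symmetric and a neighbourhood contains its
     centre. *)
  by have [symS /nbhs_singleton] := hint; exact.
have Ssp : posdefmx Ss by apply: hThetaS; case: Xs.
have loss_ge0 th : (0 <= sme_loss phi dD (As, Ss) th)%E.
  by apply: expectation_ge0 => z; apply: sumr_ge0 => i _; exact: sqr_ge0.
have losss : sme_loss phi dD (As, Ss) (As, Ss) = 0%E.
  rewrite /sme_loss unlock; apply: integral0_eq => z _; rewrite subrr /sqnorm2 big1//.
  by move=> i _; rewrite mxE expr0n.
split; [exact: Xs|by move=> th _; rewrite losss; exact: loss_ge0|].
move=> [A S] Xth Lth.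
(* A minimizer has loss at most that of [(As, Ss)], which is 0. *)
have L0 : sme_loss phi dD (As, Ss) (A, S) = 0%E.
  by apply/eqP; rewrite eq_le loss_ge0 andbT -losss (Lth _ Xs).
have Sp : posdefmx S by apply: hThetaS; case: Xth.
apply/(hident _ _ Xth Xs) => x x'.
exact: (sme_loss0_transition_density hphi Ssp hdD Sp L0 x' x).
Qed.
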